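(* Let $(X,T)$ be a transitive system, $n\ge2$, and let $\mathcal{F}$ be a Furstenberg family with $\{\mathbb{N}\}\subset\mathcal{F}\subset\mathcal{F}_{ps}$. Then the following are equivalent: (1) $(X,T)$ is broken $\mathcal{F}$-$n$-sensitive; (2) $(X,T)$ is broken $\mathcal{F}_{ps}$-$n$-sensitive; (3) $(X,T)$ is broken $\{\mathbb{N}\}$-$n$-sensitive; (4) $(X,T)$ is blockily thickly $n$-sensitive.
   Context: A (topological dynamical) system $(X,T)$ is a compact metric space $X$ with metric $d$ and a continuous surjective map $T\colon X\to X$. $\mathbb{Z}_+=\{0,1,2,\dots\}$, $\mathbb{N}=\{1,2,\dots\}$. ''Opene'' means non-empty open. $(X,T)$ is transitive if for all opene $U,V\subset X$ the set $\{k\in\mathbb{Z}_+: U\cap T^{-k}V\ne\emptyset\}$ is infinite. A Furstenberg family is a collection of subsets of $\mathbb{Z}_+$ that is closed under taking supersets in $\mathbb{Z}_+$. The condition $\{\mathbb{N}\}\subset\mathcal{F}$ means that the set $\mathbb{N}$ is a member of $\mathcal{F}$. A set $A\subset\mathbb{Z}_+$ is thick if for every $l\ge1$ there is $n_l\in\mathbb{N}$ with $\{n_l,\dots,n_l+l\}\subset A$; syndetic if there is $N\in\mathbb{N}$ such that $\{k,\dots,k+N\}\cap A\ne\emptyset$ for every $k\in\mathbb{N}$; piecewise syndetic if it is the intersection of a thick set and a syndetic set. $\mathcal{F}_{ps}$ is the family of piecewise syndetic subsets of $\mathbb{Z}_+$. For a collection $\mathcal{F}$ of subsets of $\mathbb{Z}_+$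 (including the one-element collection $\{\mathbb{N}\}$), $(X,T)$ is broken $\mathcal{F}$-$n$-sensitive if there exist $\delta>0$ and $F\in\mathcal{F}$ such that for every opene $U\subset X$ and every $l\in\mathbb{N}$ there exist $x_1^l,\dots,x_n^l\in U$ and $m_l\in\mathbb{Z}_+$ with $\min_{1\le i<j\le n}d(T^kx_i^l,T^kx_j^l)>\delta$ for all $k\in m_l+(F\cap[1,l])$. $(X,T)$ is blockily thickly $n$-sensitive if there is $\delta>0$ such that for every $k\in\mathbb{N}$ and every opene $U\subset X$ there are $x_1^k,\dots,x_n^k\in U$ and $m_k\in\mathbb{N}$ with $\{m_k,m_k+1,\dots,m_k+k\}\subset\{m\in\mathbb{N}:\min_{1\le i<j\le n}d(T^mx_i^k,T^mx_j^k)>\delta\}$. *)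

(* Defs.v *)
From mathcomp Require Import all_boot all_order all_algebra.
From mathcomp Require Import all_classical all_reals all_analysis.
Set Implicit Arguments.
Unset Strict Implicit.
Unset Printing Implicit Defensive.
Import Order.TTheory GRing.Theory Num.Theory.
Local Open Scope classical_set_scope.
Local Open Scope ring_scope.

(* [nat] plays the role of Z_+; [posnat] is N = {1, 2, ...} *)
Definition posnat : set nat := [set k | (0 < k)%N].

Definition furstenberg_family (F : set (set nat)) : Prop :=
  forall A B : set nat, F A -> A `<=` B -> F B.

Definition thick (A : set nat) : Prop :=
  forall l, posnat l ->
    exists2 m, posnat m & [set k | (m <= k <= m + l)%N] `<=` A.

Definition syndetic (A : set nat) : Prop :=
  exists2 N, posnat N &
    forall k, posnat k -> [set j | (k <= j <= k + N)%N] `&` A !=set0.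

Definition piecewise_syndetic : set (set nat) :=
  [set A | exists B C, [/\ thick B, syndetic C & A = B `&` C]].

Definition opene (X : topologicalType) (U : set X) : Prop :=
  open U /\ U !=set0.

Definition is_system (R : realType) (X : metricType R) (T : X -> X) : Prop :=
  [/\ compact [set: X], continuous T & range T = [set: X]].

Definition transitive_system (R : realType) (X : metricType R)
    (T : X -> X) : Prop :=
  is_system T /\
  forall U V : set X, opene U -> opene V ->
    infinite_set [set k : nat | U `&` (iter k T @^-1` V) !=set0].

(* The minimum of d (x_i, x_j) over i < j. It is taken in \bar R so that the
   default value +oo is neutral for the minimum: as soon as 2 <= n, the set of
   pairs is nonempty and this is the usual minimum. *)
Definition min_dist (R : realType) (X : metricType R) (n : nat)
    (x : 'I_n -> X) : \bar R :=
  \big[Order.min/+oo%E]_(p : 'I_n * 'I_n | (p.1 < p.2)%N)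
     (mdist (x p.1) (x p.2))%:E.

Definition separation_times (R : realType) (X : metricType R) (T : X -> X)
    (n : nat) (x : 'I_n -> X) (delta : R) : set nat :=
  [set k | (delta%:E < min_dist (fun i => iter k T (x i)))%E].

Definition broken_sensitive (R : realType) (X : metricType R) (T : X -> X)
    (F : set (set nat)) (n : nat) : Prop :=
  exists2 delta : R, 0 < delta & exists2 A : set nat, F A &
    forall U : set X, opene U -> forall l, posnat l ->
      exists (x : 'I_n -> X) (m : nat), (forall i, U (x i)) /\
        [set (m + j)%N | j in A `&` [set j | (1 <= j <= l)%N]]
          `<=` separation_times T x delta.

Definition blockily_thickly_sensitive (R : realType) (X : metricType R)
    (T : X -> X) (n : nat) : Prop :=
  exists2 delta : R, 0 < delta &
    forall k, posnat k -> forall U : set X, opene U ->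
      exists (x : 'I_n -> X) (m : nat),
        [/\ posnat m, forall i, U (x i) &
          [set j | (m <= j <= m + k)%N]
            `<=` posnat `&` separation_times T x delta].

(* Main.v *)
Require Import Defs.
From mathcomp Require Import all_boot all_order all_algebra.
From mathcomp Require Import all_classical all_reals all_analysis.
From mathcomp Require Import zify lra.
Import Order.TTheory GRing.Theory Num.Theory.
Local Open Scope classical_set_scope.

(** Enlarging the family weakens broken sensitivity, and broken sensitivity along
    all positive times differs from blockily thick sensitivity only by a shift
    of the block by one; so the content is the passage from a piecewise
    syndetic set [A] to all positive times.

    A piecewise syndetic set has gaps bounded by some [N] along arbitrarily long
    blocks: every time [k] of such a block is followed, at most [N] steps later,
    by an element of [A] ([piecewise_syndetic_blocks]). On a compact space
    [T], ..., [T^N] are uniformly equicontinuous, so two orbits that are more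
    than [delta] apart at time [k + j] with [j <= N] are already more than some
    [delta'] apart at time [k], where [delta'] depends only on [delta] and [N]
    ([separation_times_back]). Hence [delta]-separation along [A] yields
    [delta']-separation on whole blocks of times
    ([broken_piecewise_syndetic_posnat]). *)

(** Heine-Cantor: by compactness, a radius [d] that works for all points near
    [x] works for all points at once. *)
Lemma compact_unif_continuous (R : realType) (X Y : pseudoMetricType R)
    (f : X -> Y) :
  compact [set: X] -> continuous f -> unif_continuous f.
Proof.
move=> /compact_near_coveringP cX cf; apply/unif_continuousP => e e0.
have unif_e : \forall d \near (0 : R)^'+,
    [set: X] `<=` [set x | forall y, ball x d y -> ball (f x) e (f y)].
  apply: cX => x _.
  have e20 : (0 < e / 2)%R by rewrite divr_gt0.
  have /nbhs_ballP[r /= r0 xr] : nbhs x (f @^-1` ball (f x) (e / 2)%R).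
    exact: cf (nbhsx_ballx _ _ e20).
  have r20 : (0 < r / 2)%R by rewrite divr_gt0.
  near=> z d => y zdy.
  have xz : ball x (r / 2)%R z by near: z; exact: nbhsx_ballx.
  have d_le : (d <= r / 2)%R by near: d; exact: nbhs_right_le.
  apply: (ball_splitr (z := f x)); first by apply: xr; apply: le_ball xz; lra.
  by apply: xr; exact: ball_split xz (le_ball d_le zdy).
near (0 : R)^'+ => d; exists d => //= -[x y] /= xy.
by have := near unif_e d; apply.
Unshelve. all: by end_near. Qed.

Lemma iter_equicontinuous (R : realType) (X : metricType R) (T : X -> X)
    (N : nat) (e : R) :
  unif_continuous T -> (0 < e)%R ->
  exists2 d : R, (0 < d)%R & forall j x y, (j <= N)%N ->
    (mdist x y < d)%R -> (mdist (iter j T x) (iter j T y) < e)%R.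
Proof.
move=> /unif_continuousP ucT e0.
elim: N => [|N [d d0 dP]].
  by exists e => // j x y; rewrite leqn0 => /eqP ->.
have [d' /= d'0 d'P] := ucT d d0.
exists (Num.min e d'); first by rewrite lt_min e0.
move=> [|j] x y jN; rewrite lt_min => /andP[xye xyd']; first exact: xye.
rewrite !iterSr; apply: dP => //.
by have := d'P (x, y); rewrite !ballEmdist /=; apply.
Qed.

(** The default value [+oo] of the minimum exceeds every real, so it puts no
    constraint on separation. *)
Lemma separation_timesP (R : realType) (X : metricType R) (T : X -> X)
    (n : nat) (x : 'I_n -> X) (delta : R) (k : nat) :
  separation_times T x delta k <->
  forall i j : 'I_n, (i < j)%N ->
    (delta < mdist (iter k T (x i)) (iter k T (x j)))%R.
Proof.
rewrite /separation_times /min_dist /=; split.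
  by move=> /bigmin_gtP[_ H] i j ij; have := H (i, j) ij; rewrite lte_fin.
move=> H; apply/bigmin_gtP; split; first exact: ltry.
by move=> [i j] /= ij; rewrite lte_fin; exact: H.
Qed.

(** Points that are close at time [k] stay close for the next [N] steps; this is
    the contrapositive, with [delta'] independent of the points and of [k]. *)
Lemma separation_times_back (R : realType) (X : metricType R) (T : X -> X)
    (n N : nat) (delta : R) :
  unif_continuous T -> (0 < delta)%R ->
  exists2 delta' : R, (0 < delta')%R &
    forall (x : 'I_n -> X) (k j : nat), (j <= N)%N ->
      separation_times T x delta (k + j)%N -> separation_times T x delta' k.
Proof.
move=> ucT delta0; have [d d0 dP] := iter_equicontinuous _ _ _ N _ ucT delta0.
(* halving turns the bound [d <= dist], which is what the contrapositive
   gives, into the strict inequality required by separation *)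
exists (d / 2)%R => [|x k j jN /separation_timesP sep].
  by rewrite divr_gt0.
apply/separation_timesP => a b ab; rewrite ltNge; apply/negP => le_d.
have := sep a b ab; rewrite addnC !iterD ltNge => /negP; apply.
by apply/ltW/dP => //; apply: le_lt_trans le_d _; lra.
Qed.

(** A block of length [l + N] of the thick part leaves room for the syndetic part
    to be met within [N] steps of each of the first [l + 1] times. *)
Lemma piecewise_syndetic_blocks (A : set nat) :
  piecewise_syndetic A ->
  exists N, forall l, exists2 p, posnat p &
    forall k, (p <= k <= p + l)%N -> exists2 j, (j <= N)%N & A (k + j)%N.
Proof.
move=> [B [C [thickB [N N0 syndC] ->]]]; exists N => l.
have [p p0 pB] := thickB (l + N)%N (leq_trans N0 (leq_addl _ _)).
exists p => // k /andP[pk kpl].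
have [i [/= /andP[ki ikN] Ci]] := syndC k (leq_trans p0 pk).
exists (i - k)%N; first by rewrite leq_subLR.
by rewrite subnKC//; split => //; apply: pB => /=; lia.
Qed.

Lemma broken_sensitive_mono (R : realType) (X : metricType R) (T : X -> X)
    (n : nat) (F G : set (set nat)) :
  F `<=` G -> broken_sensitive T F n -> broken_sensitive T G n.
Proof. by move=> FG [delta d0 [A /FG GA H]]; exists delta => //; exists A. Qed.

Lemma broken_piecewise_syndetic_posnat (R : realType) (X : metricType R)
    (T : X -> X) (n : nat) :
  unif_continuous T ->
  broken_sensitive T piecewise_syndetic n ->
  broken_sensitive T [set posnat] n.
Proof.
move=> ucT [delta delta0 [A /piecewise_syndetic_blocks[N blocks] sens]].
have [delta' delta'0 back] := separation_times_back _ _ _ n N _ ucT delta0.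
exists delta' => //; exists posnat => // U oU l l0.
have [p p0 pP] := blocks l.
(* [A] meets the window [1, p + l + N] within [N] steps of every time of the
   block [p, p + l]; shifting by [p] moves this block to the origin *)
have [x [m [Ux sep]]] := sens U oU (p + l + N)%N (ltn_addr _ (ltn_addr _ p0)).
exists x, (m + p)%N; split=> // _ [i [/= i0 /andP[_ il]] <-].
have [|j jN Aj] := pP (p + i)%N; first by lia.
apply: (back x _ j) => //; apply: sep; exists (p + i + j)%N; last by lia.
by split => //=; rewrite /posnat /= in p0 *; lia.
Qed.

Lemma broken_posnat_blockily (R : realType) (X : metricType R) (T : X -> X)
    (n : nat) :
  broken_sensitive T [set posnat] n <-> blockily_thickly_sensitive T n.
Proof.
split=> [[delta delta0 [_ -> sens]]|[delta delta0 sens]]; exists delta => //.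
  move=> k k0 U oU; have [x [m [Ux sep]]] := sens U oU k.+1 isT.
  (* the block starts at [m + 1], the image of the first positive time *)
  exists x, m.+1; split=> // i /= /andP[mi ik]; split; first exact: leq_trans mi.
  by apply: sep; exists (i - m)%N; [split=> /=; rewrite /posnat /=; lia | lia].
exists posnat => // U oU l l0; have [x [m [_ Ux sep]]] := sens l l0 U oU.
exists x, m; split=> // _ [i [_ /= /andP[i1 il]] <-].
by have [|] := sep (m + i)%N; first by rewrite /=; lia.
Qed.

Theorem mainTheorem5 (R : realType) (X : metricType R) (T : X -> X)
    (n : nat) (F : set (set nat)) :
  transitive_system T -> (2 <= n)%N ->
  furstenberg_family F ->
  [set posnat] `<=` F -> F `<=` piecewise_syndetic ->
  [<-> broken_sensitive T F n;
       broken_sensitive T piecewise_syndetic n;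
       broken_sensitive T [set posnat] n;
       blockily_thickly_sensitive T n].
Proof.
move=> [[cX cT _] _] _ _ posF Fps; tfae.
- exact: broken_sensitive_mono.
- exact/broken_piecewise_syndetic_posnat/compact_unif_continuous.
- by move/broken_posnat_blockily.
- by move/broken_posnat_blockily; exact: broken_sensitive_mono.
Qed.
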